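(* Let $n\ge 1$ be an integer and let $U_{6n}=\langle x,y : x^{2n}=y^3=1,\ x^{-1}yx=y^{-1}\rangle$. Then the CN-spectrum and CN-energy of its commuting conjugacy class graph are $$\text{CN-spec}(\Gamma(U_{6n}))=\{(-(n-2))^{2(n-1)},\ ((n-1)(n-2))^2\}$$ and $$E_{CN}(\Gamma(U_{6n}))=4(n-1)(n-2).$$
   Context: For a finite non-abelian group $G$, the commuting conjugacy class graph $\Gamma(G)$ is the simple undirected graph whose vertices are the conjugacy classes of the non-central elements of $G$; two distinct vertices $a^G$ and $b^G$ are adjacent if there exist $a'\in a^G$, $b'\in b^G$ with $a'b'=b'a'$. For a finite simple graph $\mathcal{G}$ with vertices $v_1,\dots,v_N$, the common neighbourhood matrix $CN(\mathcal{G})$ is the $N\times N$ matrix whose $(i,j)$ entry is, for $i\ne j$, the number of vertices other than $v_i,v_j$ adjacent to both $v_i$ and $v_j$, and is $0$ for $i=j$. The CN-spectrum $\text{CN-spec}(\mathcal{G})$ is the multiset of eigenvalues of $CN(\mathcal{G})$; writing $\{\lambda_1^{\alpha_1},\dots,\lambda_k^{\alpha_k}\}$ means that $\lambda_i$ is listed $\alpha_i$ times (multiplicities of coinciding values add up; entries with exponent $0$ are absent). The CN-energy $E_{CN}(\mathcal{G})$ is the sum of the absolute values of the eigenvalues of $CN(\mathcal{G})$, counted with multiplicity. *)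

(* Defs.v *)
From mathcomp Require Import all_boot all_order all_algebra all_fingroup.
From mathcomp Require Import all_solvable all_field.

Set Implicit Arguments.
Unset Strict Implicit.
Unset Printing Implicit Defensive.

Import Order.TTheory GRing.Theory Num.Theory.

Record sgraph := SGraph {
  vertex :> finType;
  adj : rel vertex;
  adj_sym : symmetric adj;
  adj_irrefl : irreflexive adj
}.

Section CommonNeighbourhood.

Variable g : sgraph.

Definition common_neighbours (u v : g) : {set g} :=
  [set w | [&& w != u, w != v, adj u w & adj v w]].

(* The vertices are numbered by enum_val : 'I_#|g| -> g. *)
Definition CN_matrix : 'M[algC]_#|g| :=
  \matrix_(i, j) (if i == j then 0
                  else #|common_neighbours (enum_val i) (enum_val j)|%:R)%R.

End CommonNeighbourhood.

(* Eigenvalues with multiplicity: the roots of the (monic) characteristic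
   polynomial. The order of this list is arbitrary, so spectra are to be
   compared with perm_eq. *)
Definition spectrum n (A : 'M[algC]_n) : seq algC :=
  sval (closed_field_poly_normal (char_poly A)).

Lemma spectrumP n (A : 'M[algC]_n) :
  (char_poly A = \prod_(a <- spectrum A) ('X - a%:P))%R.
Proof.
rewrite /spectrum; case: closed_field_poly_normal => s /= {1}->.
by rewrite (monicP (char_poly_monic A)) scale1r.
Qed.

Definition CN_spec (g : sgraph) : seq algC := spectrum (CN_matrix g).

Definition CN_energy (g : sgraph) : algC := (\sum_(a <- CN_spec g) `|a|)%R.

Section CommutingConjugacyClassGraph.

Variables (gT : finGroupType) (G : {group gT}).
Local Open Scope group_scope.

Definition noncentral_classes : {set {set gT}} :=
  [set x ^: G | x in G :\: 'Z(G)].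

Definition nc_class : finType := {C : {set gT} | C \in noncentral_classes}.

Definition ccc_adj : rel nc_class := fun C D =>
  (C != D) && [exists a in val C, exists b in val D, a * b == b * a].

Lemma ccc_adj_sym : symmetric ccc_adj.
Proof.
move=> C D; rewrite /ccc_adj eq_sym; congr (_ && _).
by apply/exists_inP/exists_inP => -[a Ca /exists_inP[b Db /eqP ab]];
  exists b => //; apply/exists_inP; exists a; rewrite // ab.
Qed.

Lemma ccc_adj_irrefl : irreflexive ccc_adj.
Proof. by move=> C; rewrite /ccc_adj eqxx. Qed.

Definition ccc_graph : sgraph := SGraph ccc_adj_sym ccc_adj_irrefl.

End CommutingConjugacyClassGraph.

(* G is (isomorphic to) the group U_6n given by the presentation; y ^ x is the
   conjugate x^-1 * y * x. isoGrp tests the universal property on finite groups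
   only, which determines G since the presented group is finite. *)
Definition is_U6n (n : nat) (gT : finGroupType) (G : {group gT}) : Prop :=
  (G \isog Grp (x : y : x ^+ (2 * n)%N = y ^+ 3 = 1, y ^ x = y^-1))%g.

Lemma is_U6n_exists (n : nat) :
  0 < n -> exists (gT : finGroupType) (G : {group gT}), is_U6n n G.
Proof.
move=> n_gt0; exists (Extremal.gtype 3 (2 * n) 2), [set: _]%G => rT H.
rewrite (@Grp_ext_dihedral 3 _ (2 * n)) ?dvdn_mulr //; last first.
  by rewrite (leq_trans _ (leq_mul (leqnn 2) n_gt0)).
apply/existsP/existsP => -[[x y]] /=; rewrite !xpair_eqE /=.
  by case/and4P=> gH x3 yn xy; exists (y, x);
  rewrite /= !xpair_eqE joingC gH x3 yn.
by case/and4P=> gH xn y3 xy; exists (y, x);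
  rewrite /= !xpair_eqE joingC gH xn y3.
Qed.

(* Main.v *)
Require Import Defs.
From mathcomp Require Import all_boot all_order all_algebra all_fingroup.
From mathcomp Require Import all_solvable all_field.
From mathcomp Require Import ring zify.
Import Order.TTheory GRing.Theory Num.Theory.

(** The commuting conjugacy class graph of G = U_6n is a disjoint union of two
    complete graphs K_n.

    The subgroup A generated by y and x ^+ 2 is abelian, has index 2 and order
    3n, and contains the centre <x ^+ 2>, of order n. A noncentral element of A
    has centraliser A, hence a class of size 2, and there are 2n of them, so n
    classes. An element outside A is conjugate to an odd power of x and has a
    conjugate of <x> as centraliser, hence a class of size 3, and there are 3n
    of them, so again n classes (card_abelian_part). Classes on the same side
    commute because A and <x> are abelian; classes on different sides do not,
    because the centraliser of a noncentral element of A is A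
    (adj_abelian_part).

    For a disjoint union of cliques of size m, two vertices of the same clique
    have m - 2 common neighbours and two vertices of different cliques have
    none, so the common neighbourhood matrix is (m - 2)(B B^T - 1) with B the
    incidence matrix of vertices against cliques. As B^T B = m, Sylvester's
    determinant identity det_scalar_sub_mulmxC gives its characteristic
    polynomial (char_poly_clique_mx). *)

(** * Spectrum of a disjoint union of cliques of equal size *)

(** Sylvester's determinant identity, read off by eliminating either one of the
    off-diagonal blocks of the block matrix with rows (t, A) and (B, 1). The
    powers of t stand in for the inverse of t, so that t may be
    indeterminate. *)
Lemma det_scalar_sub_mulmxC {R : comNzRingType} {m n : nat} (t : R)
    (A : 'M[R]_(m, n)) (B : 'M[R]_(n, m)) :
  (t ^+ n * \det (t%:M - A *m B) = t ^+ m * \det (t%:M - B *m A))%R.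
Proof.
pose M := block_mx t%:M%R A B (1%:M)%R.
have MC : (M *m block_mx 1%:M 0 (- B) 1%:M
    = block_mx (t%:M - A *m B) A 0 1%:M)%R.
  by rewrite mulmx_block !mulmx1 !mulmx0 !mul1mx !add0r mulmxN addrN.
have MR : (block_mx 1%:M 0 (- B) t%:M *m M
    = block_mx t%:M A 0 (t%:M - B *m A))%R.
  rewrite mulmx_block !mul1mx !mul0mx !addr0 mulmx1 !mulNmx.
  by rewrite mul_mx_scalar mul_scalar_mx addNr addrC.
have /(congr1 (fun x => t ^+ n * x)%R) := congr1 determinant MC.
have := congr1 determinant MR.
rewrite !det_mulmx !det_ublock !det_lblock !det1 !det_scalar !mul1r !mulr1.
by move=> -> <-.
Qed.

(** If B is the incidence matrix of indices against the fibres of h, this matrix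
    is c B B^T - c, while B^T B = m since distinct fibres are disjoint and each
    has m elements. Sylvester's identity thus reduces its characteristic
    polynomial to the determinant of a scalar matrix of size #|T|. *)
Lemma char_poly_clique_mx {F : fieldType} {T : finType} {N m : nat}
    (h : 'I_N -> T) (c : F) :
    0 < m -> (forall x, #|[set i | h i == x]| = m) ->
  (char_poly (\matrix_(i, j) (if i == j then 0 else c *+ (h i == h j)))
   = ('X - (- c)%:P) ^+ (#|T| * m.-1) *
     ('X - ((m%:R - 1) * c)%:P) ^+ #|T|)%R.
Proof.
move=> m_gt0 card_h.
have defN : N = (#|T| * m)%N.
  rewrite -[LHS]card_ord -sum1_card (partition_big h predT) //=.
  rewrite -sum_nat_const; apply: eq_bigr => x _.
  by rewrite sum1_card -(card_h x) cardsE.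
pose t : {poly F} := ('X - (- c)%:P)%R.
pose B : 'M[{poly F}]_(N, #|T|) := (\matrix_(i, k) (h i == enum_val k)%:R)%R.
have defM : char_poly_mx
    (\matrix_(i, j) (if i == j then 0 else c *+ (h i == h j)))%R
    = (t%:M - (c%:P *: B) *m B^T)%R.
  apply/matrixP => i j; rewrite !mxE.
  rewrite (bigD1 (enum_rank (h i))) //= big1 ?addr0; last first.
    move=> k ne_k; rewrite !mxE eq_sym; case: eqP => [hk|_].
      by rewrite -hk enum_valK eqxx in ne_k.
    by rewrite mulr0 mul0r.
  rewrite !mxE !enum_rankK eqxx mulr1 [h j == _]eq_sym /t.
  case: eqVneq => [->|_].
    by rewrite eqxx !mulr1n mulr1 polyCN opprK polyC0 subr0 addrK.
  rewrite !mulr0n !sub0r.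
  by case: (h i == h j); rewrite ?mulr1 ?mulr0 ?mulr1n ?polyC0.
have BtB : (B^T *m (c%:P *: B) = (m%:R * c)%:P%:M)%R.
  apply/matrixP => k l; rewrite !mxE.
  under eq_bigr => i _ do rewrite !mxE mulrCA -natrM mulnb.
  rewrite -mulr_sumr -natr_sum.
  have [<-|ne_kl] := eqVneq k l; last first.
    rewrite big1 ?mulr0 // => i _; apply/eqP; rewrite eqb0; apply: contra ne_kl.
    by case/andP => /eqP-> /eqP /enum_val_inj->.
  rewrite mulr1n polyCM mulrC; congr (_ * _)%R.
  rewrite polyC_natr -(card_h (enum_val k)) -sum1_card; congr (_%:R)%R.
  rewrite [RHS]big_mkcond /=; apply: eq_bigr => i _.
  by rewrite inE andbb; case: eqP.
have := det_scalar_sub_mulmxC t (c%:P *: B)%R B^T%R.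
rewrite -defM BtB -raddfB det_scalar -/(char_poly _) => E.
have t_neq0 : (t ^+ #|T| != 0)%R by rewrite expf_neq0 // polyXsubC_eq0.
apply: (mulfI t_neq0); rewrite E mulrA -exprD -mulnS prednK // defN.
by rewrite /t -addrA -opprD -polyCD mulrBl mul1r [(- c + _)%R]addrC.
Qed.

(** When adjacency means lying in the same fibre of f, the common neighbours of
    two vertices of one fibre are the m - 2 other elements of that fibre, and
    vertices of different fibres have none. *)
Lemma CN_matrix_cliques {g : sgraph} {T : finType} {m : nat} {f : g -> T} :
    (forall u v, adj u v = (u != v) && (f u == f v)) ->
    (forall x, #|[set v | f v == x]| = m) ->
  CN_matrix g = (\matrix_(i, j) (if i == j then 0
    else (m%:R - 2) *+ (f (enum_val i) == f (enum_val j))))%R.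
Proof.
move=> adjE card_f; apply/matrixP => i j; rewrite !mxE.
case: eqVneq => // ne_ij.
set u := enum_val i; set v := enum_val j.
have ne_uv : u != v by apply: contra ne_ij => /eqP/enum_val_inj->.
have defCN : common_neighbours u v
    = [set w | (f u == f v) && (f w == f u)] :\: [set u; v].
  apply/setP => w; rewrite !inE !adjE negb_or -andbA ![_ == w]eq_sym.
  case: (w == u) => //=; case: (w == v) => //=.
  rewrite [f w == f u]eq_sym [RHS]andbC.
  by case: (f u =P f w) => //= <-; apply: eq_sym.
rewrite defCN; case: eqP => /= [fuv|_]; last first.
  have -> : [set w : g | false] = set0 by apply/setP=> w; rewrite !inE.
  by rewrite set0D cards0.
have sub_uv : [set u; v] \subset [set w | f w == f u].
  by apply/subsetP => w; rewrite !inE => /orP[] /eqP->; rewrite ?fuv.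
rewrite cardsD (setIidPr sub_uv) card_f cards2 ne_uv mulr1n natrB //.
rewrite -(card_f (f u)) (leq_trans _ (subset_leq_card sub_uv)) //.
by rewrite cards2 ne_uv.
Qed.

Lemma CN_spec_cliques {g : sgraph} {T : finType} {m : nat} {f : g -> T} :
    0 < m -> (forall u v, adj u v = (u != v) && (f u == f v)) ->
    (forall x, #|[set v | f v == x]| = m) ->
  perm_eq (CN_spec g)
    (nseq (#|T| * m.-1) (- (m%:R - 2))%R
      ++ nseq #|T| ((m%:R - 1) * (m%:R - 2))%R).
Proof.
move=> m_gt0 adjE card_f; apply: prod_XsubC_eq.
rewrite -spectrumP (CN_matrix_cliques adjE card_f).
rewrite (char_poly_clique_mx (fun i => f (enum_val i)) _ m_gt0); last first.
  move=> x; rewrite -(card_f x) -[RHS](card_imset _ enum_rank_inj).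
  apply: eq_card => i.
  apply/idP/imsetP.
    by rewrite !inE => fi; exists (enum_val i); rewrite ?inE ?enum_valK.
  by case=> v; rewrite !inE => fv ->; rewrite enum_rankK.
by rewrite big_cat !big_nseq /= !iter_mulr_1.
Qed.

(** The -(m - 2) and the (m - 1)(m - 2) contribute equally to the energy. The
    case m = 1, where m - 2 is negative, is harmless because both contributions
    then vanish. *)
Lemma CN_energy_cliques {g : sgraph} {T : finType} {m : nat} {f : g -> T} :
    0 < m -> (forall u v, adj u v = (u != v) && (f u == f v)) ->
    (forall x, #|[set v | f v == x]| = m) ->
  CN_energy g = ((2 * #|T|)%:R * (m%:R - 1) * (m%:R - 2))%R.
Proof.
move=> m_gt0 adjE card_f.
rewrite /CN_energy (perm_big _ (CN_spec_cliques m_gt0 adjE card_f)).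
rewrite big_cat !big_nseq /= !iter_addr_0 normrN natrM.
case: m m_gt0 {card_f} => [|[|k]] //= _.
  by rewrite muln0 mulr0n subrr mulr0 !mul0r normr0 mul0rn addr0.
have -> : (k.+2%:R - 2 = k%:R :> algC)%R by rewrite -addn2 natrD addrK.
have -> : (k.+2%:R - 1 = k.+1%:R :> algC)%R by rewrite -addn1 natrD addrK.
rewrite normrM !normr_nat -[(k%:R *+ _)%R]mulr_natl.
rewrite -[(_ * _ *+ _)%R]mulr_natl !natrM.
ring.
Qed.

(** * The group U_6n *)

Section Presentation.

Local Open Scope group_scope.

(** The presentation forces order at most 6n, since G is the product of <y>,
    of order at most 3, and <x>, of order at most 2n. Equality needs a model:
    the extended dihedral group, a concrete group of order 6n, has generators
    satisfying the relations, hence is a quotient of G. *)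
Lemma is_U6n_generators {n : nat} {gT : finGroupType} {G : {group gT}} :
    0 < n -> is_U6n n G ->
  exists x y : gT, [/\ <[x]> <*> <[y]> = G, x ^+ (2 * n) = 1, y ^+ 3 = 1,
    y ^ x = y^-1 & #|G| = (6 * n)%N].
Proof.
move=> n_gt0 defG.
have n2_gt1 : 1 < 2 * n by lia.
have n2_even : 2 %| 2 * n by rewrite dvdn_mulr.
pose D := [set: Extremal.gtype 3 (2 * n) 2]%G.
have oD0 := @card_ext_dihedral 3 isT _ n2_gt1 n2_even.
have oD : #|D| = (6 * n)%N by rewrite [LHS]oD0 mul2n doubleK mulnC.
have DG : D \homg G.
  rewrite defG.
  have := isoGrp_hom (Grp_ext_dihedral (isT : 1 < 3) n2_gt1 n2_even).
  case/existsP=> -[y x] /=; rewrite !xpair_eqE /= => /and4P[gD y3 xn yx].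
  by apply/existsP; exists (x, y); rewrite /= !xpair_eqE joingC gD xn y3.
have := isoGrp_hom defG.
case/existsP=> -[x y] /=; rewrite !xpair_eqE /=.
move=> /and4P[/eqP gG /eqP xn /eqP y3 /eqP yx].
exists x, y; split=> //; apply/eqP.
rewrite eqn_leq -{2}oD andbC dvdn_leq ?card_homg //=.
have nYX : <[x]> \subset 'N(<[y]>) by rewrite norms_cycle yx groupV cycle_id.
rewrite -gG joingC norm_joinEr //.
have oy : #|<[y]>| <= 3 by rewrite dvdn_leq // order_dvdn y3.
have ox : #|<[x]>| <= 2 * n by rewrite dvdn_leq ?order_dvdn ?xn ?muln_gt0.
rewrite (leq_trans (leq_pmulr _ (cardG_gt0 (<[y]> :&: <[x]>)))) // -mul_cardG.
by rewrite (leq_trans (leq_mul oy ox)) // mulnA.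
Qed.

End Presentation.

(** * Counting conjugacy classes *)

Section ClassCount.

Local Open Scope group_scope.

Context {gT : finGroupType} {G : {group gT}}.

(** A conjugation-invariant set is partitioned by the classes of its
    elements. *)
Lemma card_classes_uniform (D : {set gT}) (k : nat) :
    G \subset 'N(D) -> {in D, forall a, #|a ^: G| = k} ->
  (#|[set a ^: G | a in D]| * k)%N = #|D|.
Proof.
move=> nDG sizeD; have actD : [acts G, on D | 'J] by rewrite astabsJ.
rewrite (card_uniform_partition (n := k) _ (orbit_partition actD)); last first.
  by move=> _ /imsetP[a Da ->]; rewrite orbitJ sizeD.
by congr (#|pred_of_set _| * k)%N; apply: eq_imset => a; rewrite orbitJ.
Qed.

(** The previous count for vertices of the graph rather than bare classes: P
    selects the classes of the elements of D. *)
Lemma card_nc_class (P : pred {set gT}) (D : {set gT}) (k : nat) :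
    D \subset G :\: 'Z(G) -> G \subset 'N(D) ->
    {in G :\: 'Z(G), forall a, P (a ^: G) = (a \in D)} ->
    {in D, forall a, #|a ^: G| = k} ->
  (#|[set C : nc_class G | P (val C)]| * k)%N = #|D|.
Proof.
move=> sDG nDG PD sizeD; rewrite -(card_classes_uniform D k) //.
congr (_ * k)%N; rewrite -(card_imset _ val_inj); apply: eq_card => C.
apply/imsetP/imsetP => [[[B /= ncB]]|[a Da ->]].
  rewrite inE /= => PB ->; have /imsetP[a Ga defB] := ncB.
  by exists a => //; rewrite -PD -?defB.
have nca : a ^: G \in noncentral_classes G.
  by apply/imsetP; exists a; rewrite ?(subsetP sDG).
exists (Sub (a ^: G) nca : nc_class G) => //.
by rewrite inE /= PD // (subsetP sDG).
Qed.

End ClassCount.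

(** * Conjugacy classes of U_6n *)

Section U6nStructure.

Local Open Scope group_scope.

Context {gT : finGroupType} {G : {group gT}} {n : nat} {x y : gT}.
Hypothesis n_gt0 : 0 < n.
Hypothesis genG : <[x]> <*> <[y]> = G.
Hypothesis xn : x ^+ (2 * n) = 1.
Hypothesis y3 : y ^+ 3 = 1.
Hypothesis yx : y ^ x = y^-1.
Hypothesis oG : #|G| = (6 * n)%N.

Let X := <[x]>%G.
Let Y := <[y]>%G.
Let Z := <[x ^+ 2]>%G.
Let A := (Y <*> Z)%G.

Let nYX : X \subset 'N(Y).
Proof. by rewrite norms_cycle yx groupV cycle_id. Qed.

Let defG : Y * X = G.
Proof. by rewrite -genG joingC norm_joinEr. Qed.

(* #|G| = 6n is the largest value that #|Y * X| can take, so both bounds on the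
   factors are attained and Y meets X trivially. *)
Let orders : [/\ #|X| = (2 * n)%N, #|Y| = 3 & Y :&: X = 1].
Proof.
have leY : #|Y| <= 3 by rewrite dvdn_leq // order_dvdn y3.
have leX : #|X| <= 2 * n by rewrite dvdn_leq ?order_dvdn ?xn ?muln_gt0.
have tiYX : Y :&: X = 1.
  by rewrite cardMg_TI // defG oG (leq_trans (leq_mul leY leX)) // mulnA.
have := TI_cardMg tiYX; rewrite defG oG => oYX.
by split=> //; nia.
Qed.

Let oX : #|X| = (2 * n)%N. Proof. by case: orders. Qed.
Let oY : #|Y| = 3. Proof. by case: orders. Qed.
Let tiYX : Y :&: X = 1. Proof. by case: orders. Qed.

Let sXG : X \subset G. Proof. by rewrite -defG mulG_subr. Qed.
Let sYG : Y \subset G. Proof. by rewrite -defG mulG_subl. Qed.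

(* Odd powers of x invert Y, as x does and x ^+ 2 centralises Y. *)
Let conjX_inv (i : nat) : odd i -> {in Y, forall u, u ^ (x ^+ i) = u^-1}.
Proof.
move=> odd_i _ /cycleP[k ->]; rewrite conjXg.
have -> : y ^ (x ^+ i) = y^-1; last by rewrite expVgn.
rewrite -(odd_double_half i) odd_i add1n; elim: i./2 => [|j IHj] //.
by rewrite doubleS 2!expgSr 2!conjgM IHj conjVg yx invgK yx.
Qed.

Let cYZ : Z \subset 'C(Y).
Proof.
rewrite cycle_subG /= cent_cycle; apply/cent1P/commute_sym/commgP/conjg_fixP.
by rewrite conjgM yx conjVg yx invgK.
Qed.

Let defA : Y * Z = A.
Proof. by rewrite /A /= cent_joinEr. Qed.

Let abA : abelian A.
Proof. by rewrite abelianY !cycle_abelian. Qed.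

Let sZX : Z \subset X.
Proof. by rewrite cycle_subG mem_cycle. Qed.

Let sAG : A \subset G.
Proof. by rewrite join_subG sYG (subset_trans sZX). Qed.

Let oZ : #|Z| = n.
Proof.
have ox : #[x] = (2 * n)%N := oX.
by rewrite -[LHS]/(#[x ^+ 2]) orderXdiv ox ?dvdn_mulr // mulKn.
Qed.

Let oA : #|A| = (3 * n)%N.
Proof.
rewrite -defA TI_cardMg ?oY ?oZ //.
by apply/trivgP; rewrite -tiYX setIS.
Qed.

Let indexA : #|G : A| = 2.
Proof. by rewrite -divgS // oG oA -(mulnA 2 3 n) mulnK // muln_gt0. Qed.

Let normalA : A <| G.
Proof. exact: index2_normal. Qed.

Let cubeY : {in Y, forall u, u^-1 = u * u}.
Proof.
move=> u Yu; apply: (mulgI u); rewrite mulgV -(expgS u 1) -expgS.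
by apply/esym/eqP; rewrite -order_dvdn -oY order_dvdG.
Qed.

(* An element outside A is u * v with u in Y and v an odd power of x. As v
   inverts u, v ^ u = u^-2 * v = u * v because u ^+ 3 = 1. *)
Let outA_X (b : gT) : b \in G :\: A -> exists2 v, v \in b ^: G & v \in X.
Proof.
case/setDP; rewrite -{1}defG => /mulsgP[u _ Yu /cycleP[i ->] ->] notAb.
have odd_i : odd i.
  apply: contraR notAb => even_i; rewrite groupM //.
    by rewrite (subsetP (joing_subl _ _)).
  rewrite (subsetP (joing_subr _ _)) // -(odd_double_half i) (negbTE even_i).
  by rewrite -mul2n expgM mem_cycle.
exists (x ^+ i); last exact: mem_cycle.
rewrite class_sym; apply/imsetP; exists u; first exact: (subsetP sYG).
have ux := conjX_inv i odd_i u Yu.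
rewrite conjgE mulgA (conjgC u^-1) conjVg ux invgK -mulgA -(cubeY u Yu).
by rewrite (conjgC u) ux.
Qed.

(* Commuting with x kills the Y-part u of a central element, as x inverts u and
   u has odd order; commuting with y then rules out odd powers of x. *)
Let centerG : 'Z(G) = Z.
Proof.
apply/eqP; rewrite eqEsubset; apply/andP; split; last first.
  rewrite subsetI (subset_trans sZX sXG) -genG centY subsetI cYZ.
  by rewrite andbT; exact: sub_abelian_cent2 (cycle_abelian x) sZX (subxx _).
apply/subsetP => a /centerP[]; rewrite -{1}defG => /mulsgP[u v Yu Xv ->] ca.
have Gx : x \in G by rewrite (subsetP sXG) ?cycle_id.
have Gy : y \in G by rewrite (subsetP sYG) ?cycle_id.
have vx : v ^ x = v.
  apply/conjg_fixP/commgP; case/cycleP: Xv => i ->.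
  exact/commute_sym/commuteX.
have u1 : u = 1.
  have /commgP/conjg_fixP := ca x Gx; rewrite conjMg vx => /mulIg.
  rewrite -[x]expg1 conjX_inv // cubeY // => /(canRL (mulgK u)).
  by rewrite mulgV.
move: ca Xv; rewrite u1 mul1g => cv /cycleP[i defv]; rewrite defv in cv *.
have even_i : ~~ odd i.
  apply/negP => odd_i.
  have /commute_sym/commgP/conjg_fixP := cv y Gy.
  rewrite conjX_inv ?cycle_id // cubeY ?cycle_id // => /(canRL (mulgK y)).
  rewrite mulgV => y1; have := oY.
  by rewrite -[LHS]/(#[y]) y1 order1.
by rewrite -(odd_double_half i) (negbTE even_i) -mul2n expgM mem_cycle.
Qed.

(* A is abelian of prime index, hence maximal, so the centraliser of a
   noncentral element of A can only be A. *)
Let cent_inA (a : gT) : a \in A :\: 'Z(G) -> 'C_G[a] = A.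
Proof.
case/setDP => Aa notZa.
have maxA : maximal A G by rewrite p_index_maximal // indexA.
have sAC : A \subset 'C_G[a].
  by rewrite subsetI sAG sub_cent1 (subsetP abA).
have /maximal_eqP[_ maxAP] : maximal_eq A G by rewrite /maximal_eq maxA orbT.
case: (maxAP _ sAC (subsetIl _ _)) => // CG.
case/negP: notZa; apply/centerP; split; first exact: (subsetP sAG).
move=> b; rewrite -{1}CG => /setIP[_ /cent1P]; exact: commute_sym.
Qed.

Let size_inA : {in A :\: 'Z(G), forall a, #|a ^: G| = 2}.
Proof. by move=> a Aa; rewrite -index_cent1 cent_inA. Qed.

Let outA_noncentral : G :\: A \subset G :\: 'Z(G).
Proof. by rewrite centerG setDS // joing_subr. Qed.

(* The class of an element outside A meets X, an abelian subgroup of prime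
   index 3, hence maximal, so a representative in X has centraliser X. *)
Let size_outA : {in G :\: A, forall b, #|b ^: G| = 3}.
Proof.
move=> b nAb; have [v vb Xv] := outA_X b nAb.
have /setDP[Gb notZb] := subsetP outA_noncentral b nAb.
rewrite -(class_eqP vb) -index_cent1.
have iX : #|G : X| = 3.
  by rewrite -divgS // oG oX -(mulnA 3 2 n) mulnK // muln_gt0.
have maxX : maximal X G by rewrite p_index_maximal // iX.
have sXC : X \subset 'C_G[v].
  by rewrite subsetI sXG sub_cent1 (subsetP (cycle_abelian x)).
have /maximal_eqP[_ maxXP] : maximal_eq X G by rewrite /maximal_eq maxX orbT.
case: (maxXP _ sXC (subsetIl _ _)) => [->//|CG].
case/negP: notZb; have Zv : v \in 'Z(G).
  apply/centerP; split; first exact: (subsetP sXG).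
  move=> c; rewrite -{1}CG => /setIP[_ /cent1P]; exact: commute_sym.
have := vb; rewrite class_sym => /imsetP[c Gc ->].
by rewrite memJ_norm // (subsetP (gFnorm _ _)).
Qed.

(** For classes of noncentral elements, containment in A is the same as meeting
    A, which is normal; the two values of this predicate are the two connected
    components of the graph. *)
Definition abelian_part (C : nc_class G) : bool := val C \subset A.

Let classA : {in G :\: 'Z(G), forall a, (a ^: G \subset A) = (a \in A)}.
Proof.
move=> a _; apply/idP/idP => [sA|Aa].
  exact: subsetP sA _ (class_refl _ _).
by rewrite class_sub_norm ?normal_norm.
Qed.

(** The 3n - n noncentral elements of A lie in classes of size 2, the 3n
    elements outside A in classes of size 3. *)
Lemma card_abelian_part (r : bool) :
  #|[set C : nc_class G | abelian_part C == r]| = n.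
Proof.
have nZG : G \subset 'N('Z(G)) by rewrite gFnorm.
have nAG := normal_norm normalA.
have sZA : Z \subset A by rewrite joing_subr.
case: r.
  have := @card_nc_class _ G (fun C => (C \subset A) == true) (A :\: 'Z(G)) 2.
  rewrite [#|A :\: _|]cardsD centerG (setIidPr sZA) oA oZ -centerG.
  move=> /(_ (setSD _ sAG) (normsD nAG nZG)) oC.
  suff: (#|[set C : nc_class G | abelian_part C == true]| * 2)%N
      = (3 * n - n)%N by lia.
  apply: oC size_inA => a Ga; rewrite eqb_id classA // inE.
  by case/setDP: Ga => _ ->.
have := @card_nc_class _ G (fun C => (C \subset A) == false) (G :\: A) 3.
rewrite [#|G :\: _|]cardsD (setIidPr sAG) oA oG.
move=> /(_ outA_noncentral (normsD (normG _) nAG)) oC.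
suff: (#|[set C : nc_class G | abelian_part C == false]| * 3)%N
    = (6 * n - 3 * n)%N by lia.
apply: oC size_outA => a Ga; rewrite eqbF_neg classA // inE.
by case/setDP: Ga => ->; rewrite andbT.
Qed.

(** Classes inside A commute because A is abelian, and classes outside A all
    meet the cyclic group X; but nothing outside A commutes with a noncentral
    element of A, whose centraliser is A. *)
Lemma adj_abelian_part (C D : ccc_graph G) :
  adj C D = (C != D) && (abelian_part C == abelian_part D).
Proof.
rewrite /adj /= /ccc_adj; congr (_ && _).
have /imsetP[a Ga defC] := valP C; have /imsetP[b Gb defD] := valP D.
have Ca : a \in val C by rewrite defC class_refl.
have Db : b \in val D by rewrite defD class_refl.
rewrite /abelian_part {2}defC {2}defD !classA //.
have mixed (E F : nc_class G) :
    val E \subset A -> ~~ (val F \subset A) ->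
  forall c d, c \in val E -> d \in val F -> c * d != d * c.
  have /imsetP[e Ge ->] := valP E; have /imsetP[f Gf ->] := valP F.
  move=> sEA nsFA c d Ec Fd; apply: contra nsFA => /eqP cd.
  have Ac : c \in A :\: 'Z(G).
    rewrite inE (subsetP sEA) // andbT; case/imsetP: Ec => g Gg ->.
    by rewrite memJ_norm ?(subsetP (gFnorm _ _)) //; case/setDP: Ge.
  have Gd : d \in G.
    by apply: subsetP Fd; rewrite class_subG //; case/setDP: Gf.
  have : d \in 'C_G[c] by rewrite inE Gd; apply/cent1P; apply: esym.
  by rewrite cent_inA // -(class_eqP Fd) class_sub_norm ?normal_norm.
case: (boolP (a \in A)) => Aa; case: (boolP (b \in A)) => Ab /=.
- apply/exists_inP; exists a => //; apply/exists_inP; exists b => //.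
  by apply/eqP/(centsP abA).
- apply/negbTE/exists_inPn => c Cc; apply/exists_inPn => d Dd.
  by apply: (mixed C D); rewrite // ?defC ?defD classA.
- apply/negbTE/exists_inPn => c Cc; apply/exists_inPn => d Dd.
  by rewrite eq_sym; apply: (mixed D C); rewrite // ?defC ?defD classA.
have [|v vC Xv] := outA_X a; first by rewrite inE Aa; case/setDP: Ga.
have [|w wD Xw] := outA_X b; first by rewrite inE Ab; case/setDP: Gb.
apply/exists_inP; exists v; first by rewrite defC.
apply/exists_inP; exists w; first by rewrite defD.
by apply/eqP/(centsP (cycle_abelian x)).
Qed.

End U6nStructure.

(** * Spectrum and energy of the graph of U_6n *)

Theorem corollary2p6 (n : nat) (n_ge1 : (1 <= n)%N)
    (gT : finGroupType) (G : {group gT}) (U6n_G : is_U6n n G) :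
  perm_eq (CN_spec (ccc_graph G))
    (nseq (2 * (n - 1))%N (- (n%:R - 2))%R
      ++ nseq 2 ((n%:R - 1) * (n%:R - 2))%R)
  /\ CN_energy (ccc_graph G) = (4 * (n%:R - 1) * (n%:R - 2))%R.
Proof.
have [x [y [genG xn y3 yx oG]]] := is_U6n_generators n_ge1 U6n_G.
have adjE := adj_abelian_part n_ge1 genG xn y3 yx oG.
have card_r := card_abelian_part n_ge1 genG xn y3 yx oG.
split; last by rewrite (CN_energy_cliques n_ge1 adjE card_r) card_bool.
by rewrite subn1; have := CN_spec_cliques n_ge1 adjE card_r; rewrite card_bool.
Qed.
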